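(* Let $M$ be a monoid. Then $\mathfrak{L}(\mathrm{Val},\mathrm{CF},M)$ either (i) equals the class of context-free languages, (ii) contains $\mathfrak{L}(\mathrm{Val},\mathrm{CF},\mathrm{B})$, (iii) contains $\mathfrak{L}(\mathrm{Val},\mathrm{CF},\mathbb{Z})$, or (iv) equals $\mathfrak{L}(\mathrm{Val},\mathrm{CF},G)$ for some infinite periodic group $G$ which is not locally finite.
   Context: A context-free valence grammar over a monoid $N$ is $(V,T,P,S,N)$ with nonterminals $V$, terminals $T$, start symbol $S$ and a finite set $P$ of rules $(A\to\alpha,n)$ with $A\in V$, $\alpha\in(V\cup T)^*$, $n\in N$. One step: $(w_1Aw_2,m)\Rightarrow(w_1\alpha w_2,mn)$ for a rule $(A\to\alpha,n)$. The generated language is $\{w\in T^*:(S,1)\Rightarrow^*(w,1)\}$; $\mathfrak{L}(\mathrm{Val},\mathrm{CF},N)$ is the family of languages generated by such grammars over $N$. $\mathrm{B}$ is the bicyclic monoid, i.e. the monoid of partial functions on $\{x\}^*$ generated by $P:u\mapsto ux$ and $Q:ux\mapsto u$ (equivalently the monoid presentation $\langle p,q\mid pq=1\rangle$). $\mathbb{Z}$ is the additive group of integers. A group is periodic if every element has finite order, and locally finite if every finitely generated subgroup is finite. *)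

(* Defs.v *)
From mathcomp Require Import all_boot.
From Stdlib Require Import List.
From mathcomp Require Import zify.
Set Implicit Arguments. Unset Strict Implicit. Unset Printing Implicit Defensive.

Record Mnd := {
  mcar :> Type;
  mmul : mcar -> mcar -> mcar;
  mone : mcar;
  mmulA : forall x y z, mmul x (mmul y z) = mmul (mmul x y) z;
  mmul1l : forall x, mmul mone x = x;
  mmul1r : forall x, mmul x mone = x }.

Record Grp := {
  gmon :> Mnd;
  ginv : gmon -> gmon;
  ginvl : forall x, mmul (ginv x) x = mone gmon }.

Fixpoint mpow (M : Mnd) (x : M) (n : nat) : M :=
  match n with O => mone M | S k => mmul x (mpow x k) end.

Definition finite_type (X : Type) : Prop := exists l : list X, forall x, In x l.

Definition periodic (G : Grp) : Prop :=
  forall g : G, exists n, (0 < n)%N /\ mpow g n = mone G.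

Inductive gen_subgroup (G : Grp) (s : list G) : G -> Prop :=
| gen_one : gen_subgroup s (mone G)
| gen_in : forall x, In x s -> gen_subgroup s x
| gen_mul : forall x y, gen_subgroup s x -> gen_subgroup s y -> gen_subgroup s (mmul x y)
| gen_inv : forall x, gen_subgroup s x -> gen_subgroup s (ginv x).

Definition locally_finite (G : Grp) : Prop :=
  forall s : list G, exists l : list G, forall x, gen_subgroup s x -> In x l.

Record valence_grammar (M : Mnd) (T : finType) := {
  vg_V : finType;
  vg_P : list (vg_V * list (vg_V + T) * M);
  vg_S : vg_V }.

Inductive vg_step (M : Mnd) (T : finType) (g : valence_grammar M T) :
  list (vg_V g + T) * M -> list (vg_V g + T) * M -> Prop :=
| vg_step_intro : forall w1 w2 A alpha n m,
    In (A, alpha, n) (vg_P g) ->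
    @vg_step M T g (w1 ++ inl A :: w2, m) (w1 ++ alpha ++ w2, mmul m n).

Inductive vg_derives (M : Mnd) (T : finType) (g : valence_grammar M T) :
  list (vg_V g + T) * M -> list (vg_V g + T) * M -> Prop :=
| vg_refl : forall c, @vg_derives M T g c c
| vg_trans : forall c1 c2 c3, @vg_step M T g c1 c2 -> @vg_derives M T g c2 c3 -> @vg_derives M T g c1 c3.

Definition vg_language (M : Mnd) (T : finType) (g : valence_grammar M T)
  (w : list T) : Prop :=
  @vg_derives M T g ([:: inl (vg_S g)], mone M) (map inr w, mone M).

Definition lang_family := forall T : finType, (list T -> Prop) -> Prop.

Definition Val_CF (M : Mnd) : lang_family :=
  fun T L => exists g : valence_grammar M T, forall w, L w <-> vg_language g w.

Record cf_grammar (T : finType) := {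
  cf_V : finType;
  cf_P : list (cf_V * list (cf_V + T));
  cf_S : cf_V }.

Inductive cf_step (T : finType) (g : cf_grammar T) :
  list (cf_V g + T) -> list (cf_V g + T) -> Prop :=
| cf_step_intro : forall w1 w2 A alpha,
    In (A, alpha) (cf_P g) -> @cf_step T g (w1 ++ inl A :: w2) (w1 ++ alpha ++ w2).

Inductive cf_derives (T : finType) (g : cf_grammar T) :
  list (cf_V g + T) -> list (cf_V g + T) -> Prop :=
| cf_refl : forall c, @cf_derives T g c c
| cf_trans : forall c1 c2 c3, @cf_step T g c1 c2 -> @cf_derives T g c2 c3 -> @cf_derives T g c1 c3.

Definition CF : lang_family :=
  fun T L => exists g : cf_grammar T,
    forall w, L w <-> @cf_derives T g [:: inl (cf_S g)] (map inr w).

Definition fam_eq (F1 F2 : lang_family) : Prop := forall T L, F1 T L <-> F2 T L.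
Definition fam_sub (F1 F2 : lang_family) : Prop := forall T L, F1 T L -> F2 T L.

(** * The bicyclic monoid B = <p, q | pq = 1>:
    the pair (i, j) represents the normal form q^i p^j. *)
Definition bmul (x y : nat * nat) : nat * nat :=
  (x.1 + (y.1 - x.2), (x.2 - y.1) + y.2)%N.

Lemma bmulA x y z : bmul x (bmul y z) = bmul (bmul x y) z.
Proof.
case: x => a b; case: y => c d; case: z => e f; rewrite /bmul /=.
congr pair; lia.
Qed.

Definition Bicyclic : Mnd.
refine {| mcar := (nat * nat)%type; mmul := bmul; mone := (0, 0)%N |}.
- exact bmulA.
- by case=> a b; rewrite /bmul /= subn0.
- by case=> a b; rewrite /bmul /= !subn0 addn0 addn0.
Defined.

Definition Zadd : Mnd.
refine {| mcar := BinInt.Z; mmul := BinInt.Z.add; mone := BinInt.Z0 |}.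
- intros; apply BinInt.Z.add_assoc.
- intros; reflexivity.
- intros; apply BinInt.Z.add_0_r.
Defined.

(* Main.v *)
Require Import Defs.
From mathcomp Require Import all_boot.
From Stdlib Require Import List.
From Stdlib Require Import Classical ProofIrrelevance.
From mathcomp Require Import zify.

(* If pq = 1 and qp <> 1 in M, then p and q generate a copy of B. Otherwise every
   factor of a product equal to 1 is a unit, so M may be replaced by its group G
   of units. An element of infinite order in G gives a copy of Z, and if G is
   periodic but not locally finite we are in case (iv). In a locally finite G a
   grammar only uses a finite subgroup H, and it remains to see that grammars
   over a finite group H generate context-free languages.

   The difficulty is that H need not be commutative while the rules of a
   derivation may be interleaved arbitrarily: the valence words of independent
   subderivations are shuffled. Call u and v equivalent if for every k the
   shuffles of u with k and those of v with k have the same set of products.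
   Equivalence is compatible with shuffling and with prefixing a letter, so once
   it has finite index, a context-free grammar can guess, at each nonterminal,
   the class of the valence word produced below it. For the finite index, a
   product of a shuffle of u with k is, up to the factor u, a product of
   conjugates of the letters of k by successive prefixes of u, so only the word
   of prefix values of u matters. If this word passes |H|^2 times through its
   whole alphabet, then every choice of conjugating letters can be realized
   (cutting a product at repeated states); otherwise it splits into boundedly
   many words over smaller alphabets. *)

Set Implicit Arguments.
Unset Strict Implicit.
Unset Printing Implicit Defensive.

Local Open Scope list_scope.
Local Notation "x ++ y" := (@app _ x y) : seq_scope.

Local Infix "**" := (@mmul _) (at level 40, left associativity).

(** * Products and shuffles of words *)

Definition mprod (M : Mnd) (u : list M) : M := fold_right (@mmul M) (mone M) u.

Lemma mprod_app (M : Mnd) (u v : list M) : mprod (u ++ v) = mprod u ** mprod v.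
Proof.
by elim: u => [|a u IH] /=; rewrite ?mmul1l // IH mmulA.
Qed.

Inductive shuffle (X : Type) : list X -> list X -> list X -> Prop :=
| shuffle_nil : shuffle nil nil nil
| shuffle_l a u v w : shuffle u v w -> shuffle (a :: u) v (a :: w)
| shuffle_r a u v w : shuffle u v w -> shuffle u (a :: v) (a :: w).

Lemma shuffle_sym (X : Type) (u v w : list X) : shuffle u v w -> shuffle v u w.
Proof. by elim=> *; constructor. Qed.

Lemma shuffle_nil_r (X : Type) (u : list X) : shuffle u nil u.
Proof. by elim: u => *; constructor. Qed.

Lemma shuffle_nil_l (X : Type) (u : list X) : shuffle nil u u.
Proof. exact/shuffle_sym/shuffle_nil_r. Qed.

Lemma shuffle_nil_r_inv (X : Type) (u v : list X) : shuffle u nil v -> v = u.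
Proof.
move=> h; move E: nil h => k h; elim: h E => // a u' v' w' _ IH E.
by rewrite IH.
Qed.

Lemma shuffle_cat (X : Type) (u v : list X) : shuffle u v (u ++ v).
Proof. by elim: u => *; [exact: shuffle_nil_l | constructor]. Qed.

Lemma shuffle_length (X : Type) (u v w : list X) :
  shuffle u v w -> length w = length u + length v.
Proof. by elim=> //= *; lia. Qed.

Lemma shuffle_assoc (X : Type) (u v w k x : list X) :
  shuffle u v w -> shuffle w k x -> exists2 y, shuffle v k y & shuffle u y x.
Proof.
move=> huv hwk; elim: hwk u v huv => {w k x}
  [|a w k x h IH|a w k x h IH] u v huv.
- by inversion huv; exists nil; constructor.
- inversion huv as [|b u' v' w' h'|b u' v' w' h']; subst.
  + by have [y ? ?] := IH _ _ h'; exists y => //; constructor.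
  + by have [y ? ?] := IH _ _ h'; exists (a :: y); constructor.
- by have [y ? ?] := IH _ _ huv; exists (a :: y); constructor.
Qed.

Lemma shuffle_assoc_rev (X : Type) (u v k y x : list X) :
  shuffle v k y -> shuffle u y x -> exists2 w, shuffle u v w & shuffle w k x.
Proof.
move=> /shuffle_sym hvk /shuffle_sym hyx.
have [w h1 h2] := shuffle_assoc hvk hyx.
by exists w; apply: shuffle_sym.
Qed.

(* Keeping the rule labels in the order of application makes the valence of a
   derivation the product of its label word, and turns independent derivations
   into shuffles of label words. *)
Inductive deriv (V T X : Type) (R : V -> list (V + T) -> X -> Prop) :
  list (V + T) -> list X -> list (V + T) -> Prop :=
| deriv_refl b : deriv R b nil b
| deriv_step w1 A w2 al x u b :
    R A al x -> deriv R (w1 ++ al ++ w2) u b ->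
    deriv R (w1 ++ inl A :: w2) (x :: u) b.

(** * Composing and splitting labelled derivations *)

Section Derivations.
Variables (V T X : Type) (R : V -> list (V + T) -> X -> Prop).

Lemma deriv_shuffle a1 u1 b1 a2 u2 b2 u :
  deriv R a1 u1 b1 -> deriv R a2 u2 b2 -> shuffle u1 u2 u ->
  deriv R (a1 ++ a2) u (b1 ++ b2).
Proof.
move=> h1 h2 hs; elim: hs a1 a2 h1 h2 => {u1 u2 u}
  [|x u1 u2 u _ IH|x u1 u2 u _ IH] a1 a2 h1 h2.
- by inversion h1; inversion h2; exact: deriv_refl.
- inversion h1 as [|w1 A w2 al y v b hR hd]; subst; rewrite -app_assoc /=.
  apply: (deriv_step hR).
  by have := IH _ _ hd h2; rewrite -!app_assoc.
- inversion h2 as [|w1 A w2 al y v b hR hd]; subst; rewrite app_assoc.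
  apply: (deriv_step hR).
  by have := IH _ _ h1 hd; rewrite -!app_assoc.
Qed.

(** A step rewrites a single nonterminal, which lies in one of the two halves; its label goes to the
    word of that half. *)
Lemma deriv_app_inv a1 a2 u w :
  deriv R (a1 ++ a2) u (map inr w) ->
  exists w1 w2 u1 u2, [/\ w = w1 ++ w2, shuffle u1 u2 u,
    deriv R a1 u1 (map inr w1) & deriv R a2 u2 (map inr w2)].
Proof.
move Ea: (a1 ++ a2) => a; move Eb: (map inr w) => b h.
elim: h a1 a2 Ea Eb => {a b u} [b|w1 A w2 al x u b hR _ IH] a1 a2 Ea Eb.
- rewrite -Eb in Ea.
  have [w1 [w2 [-> [<- <-]]]] := map_eq_app _ _ _ _ (esym Ea).
  by exists w1, w2, nil, nil; split=> //; constructor.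
- have [l [[E1 E2]|[E1 E2]]] := app_eq_app _ _ _ _ Ea.
  + case: l E1 E2 => [|s l] E1 E2.
    * rewrite app_nil_r in E1; rewrite /= in E2; subst.
      have [] := IH w1 (al ++ w2) erefl erefl.
      move=> w1' [w2' [u1 [u2 [-> hs h1 h2]]]].
      exists w1', w2', u1, (x :: u2); split=> //; first by constructor.
      exact: (@deriv_step _ _ _ _ nil _ _ _ _ _ _ hR h2).
    * case: E2 => Es E2; subst.
      have [] := IH (w1 ++ al ++ l) a2; rewrite -?app_assoc //.
      move=> w1' [w2' [u1 [u2 [-> hs h1 h2]]]].
      exists w1', w2', (x :: u1), u2; split=> //; first by constructor.
      exact: deriv_step hR h1.
  + subst.
    have [] := IH a1 (l ++ al ++ w2); rewrite -?app_assoc //.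
    move=> w1' [w2' [u1 [u2 [-> hs h1 h2]]]].
    exists w1', w2', u1, (x :: u2); split=> //; first by constructor.
    exact: deriv_step hR h2.
Qed.

Lemma deriv_nonterminal_inv A u w :
  deriv R (inl A :: nil) u (map inr w) ->
  exists al x v, [/\ u = x :: v, R A al x & deriv R al v (map inr w)].
Proof.
move=> h; inversion h as [b E1 E2 E3|w1 B w2 al x v b hR hd E1 E2 E3].
- by case: w {h} E3 E1.
- case: w1 E1 hd => [|s [|? ?]] //= [? ?] hd; subst.
  by exists al, x, v; rewrite app_nil_r in hd.
Qed.

Lemma deriv_terminal_inv t u w :
  deriv R (inr t :: nil) u (map inr w) -> u = nil /\ w = t :: nil.
Proof.
move=> h; inversion h as [b E1 E2 E3|w1 B w2 al x v b hR hd E1 E2 E3].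
- by case: w {h} E3 E1 => [|s [|? ?]] //= [->].
- by case: w1 E1 {hd} => [|s [|? ?]].
Qed.

Lemma deriv_nil_inv u w :
  deriv R nil u (map inr w) -> u = nil /\ w = nil.
Proof.
move=> h; inversion h as [b E1 E2 E3|w1 B w2 al x v b hR hd E1 E2 E3].
- by case: w {h} E3 E1.
- by case: w1 E1 {hd}.
Qed.

End Derivations.

Lemma deriv_map (V T X Y : Type) (R : V -> list (V + T) -> X -> Prop)
    (R' : V -> list (V + T) -> Y -> Prop) (f : X -> Y) a u b :
  (forall A al x, R A al x -> R' A al (f x)) ->
  deriv R a u b -> deriv R' a (map f u) b.
Proof.
move=> hf; elim=> [*|w1 A w2 al x u' b' hR _ IH] /=; first exact: deriv_refl.
exact: deriv_step (hf _ _ _ hR) IH.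
Qed.

Lemma deriv_labels (V T X : Type) (R : V -> list (V + T) -> X -> Prop) a u b x :
  deriv R a u b -> In x u -> exists A al, R A al x.
Proof.
elim=> //= w1 A w2 al y u' b' hR _ IH [<-|/IH //].
by exists A, al.
Qed.

(** * Grammars as labelled derivations, and change of monoid *)

Definition vg_rule (M : Mnd) (T : finType) (g : valence_grammar M T) A al n : Prop :=
  In (A, al, n) (vg_P g).

Definition cf_rule (T : finType) (g : cf_grammar T) A al (_ : unit) : Prop :=
  In (A, al) (cf_P g).

Lemma vg_derives_deriv (M : Mnd) (T : finType) (g : valence_grammar M T) a m b m' :
  vg_derives (g := g) (a, m) (b, m') <->
  exists2 u, deriv (vg_rule (g := g)) a u b & m' = m ** mprod u.
Proof.
split.
- move E: (a, m) => c; move E': (b, m') => c' h.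
  elim: h a m E E' => {c c'} [c a m <- [-> ->]|c1 c2 c3 hs _ IH a m E E'].
    by exists nil; [exact: deriv_refl | rewrite /= mmul1r].
  case: hs E IH => w1 w2 A al n m0 hP [-> ->] IH.
  have [u hu ->] := IH _ _ erefl E'.
  by exists (n :: u); [exact: deriv_step hP hu | rewrite /= mmulA].
- case=> u hu ->; elim: hu m => {a b u} [b|w1 A w2 al x u b hR _ IH] m.
    by rewrite /= mmul1r; exact: vg_refl.
  rewrite /= mmulA; apply: vg_trans (IH _).
  exact: vg_step_intro.
Qed.

Lemma vg_languageP (M : Mnd) (T : finType) (g : valence_grammar M T) w :
  vg_language g w <->
  exists2 u, deriv (vg_rule (g := g)) (inl (vg_S g) :: nil) u (map inr w)
    & mprod u = mone M.
Proof.
rewrite /vg_language vg_derives_deriv.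
by split=> -[u hu e]; exists u => //; move: e; rewrite mmul1l => ->.
Qed.

Lemma cf_derivesP (T : finType) (g : cf_grammar T) a b :
  cf_derives (g := g) a b <-> exists u, deriv (cf_rule (g := g)) a u b.
Proof.
split.
- elim=> {a b} [c|c1 c2 c3 hs _ [u hu]]; first by exists nil; exact: deriv_refl.
  case: hs hu => w1 w2 A al hP hu.
  by exists (tt :: u); exact: deriv_step hu.
- case=> u; elim=> {a b u} [b|w1 A w2 al x u b hR _ IH]; first exact: cf_refl.
  exact: cf_trans (cf_step_intro _ _ hR) IH.
Qed.

(** Of injectivity only the trivial kernel is kept: acceptance compares a valence with 1 and nothing
    else. *)
Record mnd_hom (N M : Mnd) (phi : N -> M) : Prop := {
  mnd_hom1 : phi (mone N) = mone M;
  mnd_homM : forall x y, phi (x ** y) = phi x ** phi y;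
  mnd_hom_eq1 : forall x, phi x = mone M -> x = mone N }.

Lemma mnd_hom_prod (N M : Mnd) (phi : N -> M) u :
  mnd_hom phi -> mprod (map phi u) = phi (mprod u).
Proof.
by case=> h1 hM _; elim: u => [|a u IH] /=; rewrite ?h1 // IH hM.
Qed.

Lemma Val_CF_hom (N M : Mnd) (phi : N -> M) :
  mnd_hom phi -> fam_sub (Val_CF N) (Val_CF M).
Proof.
move=> hphi T L [g hL].
pose P' := map (fun r : vg_V g * list (vg_V g + T) * N => (r.1, phi r.2)) (vg_P g).
pose g' := {| vg_V := vg_V g; vg_P := P'; vg_S := vg_S g |}.
exists g' => w; rewrite hL !vg_languageP; split=> -[u hu e].
- exists (map phi u); last by rewrite (mnd_hom_prod _ hphi) e; case: hphi.
  apply: deriv_map hu => A al x hR.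
  exact: (in_map (fun r : vg_V g * list (vg_V g + T) * N => (r.1, phi r.2))) hR.
- have [v hv E] : exists2 v, deriv (vg_rule (g := g)) (inl (vg_S g) :: nil) v (map inr w)
      & map phi v = u.
    move: hu; rewrite /g' /=.
    elim=> [b|w1 A w2 al x u' b hR _ [v hv E]]; first by exists nil => //; exact: deriv_refl.
    move: hR => /in_map_iff [[[A' al'] n]] /= [[E1 E2 E3] hP]; subst.
    by exists (n :: v); first exact: deriv_step hP hv.
  exists v => //; apply: (mnd_hom_eq1 hphi).
  by rewrite -(mnd_hom_prod _ hphi) E.
Qed.

(** A rule with valence in the image gets one chosen preimage, any other rule is dropped. Without
    injectivity the original [n] is recovered only up to [phi]. *)
Lemma image_rules (N M Y : Type) (phi : N -> M) (P : list (Y * M)) :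
  exists P' : list (Y * N),
    (forall y n, In (y, n) P' -> In (y, phi n) P) /\
    (forall y n, In (y, phi n) P -> exists2 n', In (y, n') P' & phi n' = phi n).
Proof.
elim: P => [|[y m] P [P' [h1 h2]]]; first by exists nil.
have [[n0 E]|hm] := classic (exists n, phi n = m).
- exists ((y, n0) :: P'); split=> y' n /= [].
  + by case=> <- <-; left; rewrite E.
  + by move/h1; right.
  + by case=> <- En; exists n0; [left | rewrite E].
  + by move/h2 => [n' ? ?]; exists n' => //; right.
- exists P'; split=> y' n; first by move/h1; right.
  case=> [[_ En]|/h2 //].
  by case: hm; exists n.
Qed.

(** A rule with valence outside the image never occurs in an accepting derivation, so dropping it
    loses no word. *)
Lemma Val_CF_image (N M : Mnd) (phi : N -> M) (T : finType)
    (g : valence_grammar M T) L :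
  mnd_hom phi ->
  (forall u, (forall m, In m u -> exists A al, vg_rule (g := g) A al m) ->
     mprod u = mone M -> forall m, In m u -> exists n, phi n = m) ->
  (forall w, L w <-> vg_language g w) -> Val_CF N L.
Proof.
move=> hphi himg hL.
have [P' [h1 h2]] := image_rules phi (vg_P g).
pose g' := {| vg_V := vg_V g; vg_P := P'; vg_S := vg_S g |}.
exists g' => w; rewrite hL !vg_languageP; split=> -[u hu e].
- have hin : forall m, In m u -> exists n, phi n = m.
    by apply: himg => // m; exact: deriv_labels hu.
  have [v hv E] : exists2 v, deriv (vg_rule (g := g')) (inl (vg_S g) :: nil) v (map inr w)
      & map phi v = u.
    elim: hu {e} hin => [b|w1 A w2 al x u' b hR _ IH] hin.
      by exists nil => //; exact: deriv_refl.
    have [n En] := hin x (or_introl erefl).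
    have [|v hv Ev] := IH; first by move=> m hm; apply: hin; right.
    move: hR; rewrite /vg_rule -En => /h2 [n' hn' En'].
    by exists (n' :: v); [exact: deriv_step hn' hv | rewrite /= Ev En'].
  exists v => //; apply: (mnd_hom_eq1 hphi).
  by rewrite -(mnd_hom_prod _ hphi) E.
- exists (map phi u); last by rewrite (mnd_hom_prod _ hphi) e; case: hphi.
  by apply: deriv_map hu => A al x; exact: h1.
Qed.

Lemma CF_sub_Val_CF (M : Mnd) : fam_sub CF (Val_CF M).
Proof.
move=> T L [g hL].
pose P' := map (fun r : cf_V g * list (cf_V g + T) => (r, mone M)) (cf_P g).
pose g' := {| vg_V := cf_V g; vg_P := P'; vg_S := cf_S g |}.
exists g' => w; rewrite hL vg_languageP cf_derivesP; split=> [[u hu]|[u hu _]].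
- exists (map (fun=> mone M) u).
    apply: deriv_map hu => A al x hR.
    exact: (in_map (fun r : cf_V g * list (cf_V g + T) => (r, mone M))) hR.
  by elim: u {hu} => //= _ u ->; rewrite mmul1l.
- exists (map (fun=> tt) u).
  apply: deriv_map hu => A al x /in_map_iff [[A' al']] [[<- <- _]].
  by [].
Qed.

(** * Embeddings and the group of units *)

Lemma mpow_add (M : Mnd) (x : M) a b : mpow x (a + b) = mpow x a ** mpow x b.
Proof. by elim: a => [|a IH] /=; rewrite ?mmul1l // IH mmulA. Qed.

Lemma mpowSr (M : Mnd) (x : M) n : mpow x n.+1 = mpow x n ** x.
Proof. by rewrite -addn1 mpow_add /= mmul1r. Qed.

Lemma mmul_inv_unique (M : Mnd) (x y z : M) :
  y ** x = mone M -> x ** z = mone M -> y = z.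
Proof. by move=> h1 h2; rewrite -(mmul1r y) -h2 mmulA h1 mmul1l. Qed.

Lemma mpow_pq (M : Mnd) (p q : M) b c : p ** q = mone M ->
  mpow p b ** mpow q c = mpow q (c - b) ** mpow p (b - c).
Proof.
move=> pq; elim: b c => [|b IH] [|c]; rewrite ?mmul1l ?mmul1r //.
rewrite mpowSr [mpow q c.+1]/= -mmulA (mmulA p) pq mmul1l IH.
by rewrite !subSS.
Qed.

(** The kernel is trivial because $p^{b+1}=1$ or $q(q^a p^b)=1$ would make [p] or [q] invertible on
    both sides, and then $qp=1$. *)
Lemma bicyclic_hom (M : Mnd) (p q : M) :
  p ** q = mone M -> q ** p <> mone M ->
  mnd_hom (fun x : Bicyclic => mpow q x.1 ** mpow p x.2).
Proof.
move=> pq qp; split=> [|[a b] [c d]|[[|a] b]] /=.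
- by rewrite mmul1l.
- rewrite !mpow_add -!mmulA; congr (_ ** _).
  by rewrite !mmulA (mpow_pq _ _ pq).
- rewrite mmul1l; case: b => [//|b] h.
  case: qp; rewrite mpowSr in h.
  by rewrite -(mmul_inv_unique h pq).
- rewrite -mmulA => h; case: qp.
  by rewrite (mmul_inv_unique pq h).
Qed.

(** Equal powers of [x] and [y] cancel in the middle, so only the difference of the exponents
    counts. *)
Lemma mpow_diff (M : Mnd) (x y : M) a b c d : x ** y = mone M -> a + d = c + b ->
  mpow x a ** mpow y b = mpow x c ** mpow y d.
Proof.
move=> xy.
have cancel n i j : mpow x (i + n) ** mpow y (n + j) = mpow x i ** mpow y j.
  by rewrite !mpow_add -!mmulA (mmulA (mpow x n)) (mpow_pq _ _ xy) subnn !mmul1l.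
move=> E; have [le|lt] := leqP a c.
- have -> : c = a + (c - a) by lia.
  have -> : d = (c - a) + b by lia.
  by rewrite cancel.
- have -> : a = c + (a - c) by lia.
  have -> : b = (a - c) + d by lia.
  by rewrite cancel.
Qed.

(** [BinInt.Z.to_nat] sends negative numbers to 0, so at most one of the two exponents is nonzero
    and [z] goes to $x^z$. *)
Lemma integers_hom (M : Mnd) (x y : M) :
  x ** y = mone M -> y ** x = mone M -> (forall n, 0 < n -> mpow x n <> mone M) ->
  mnd_hom (fun z : Zadd => mpow x (BinInt.Z.to_nat z)
                        ** mpow y (BinInt.Z.to_nat (BinInt.Z.opp z))).
Proof.
move=> xy yx hx; split=> [|a b|z].
- by rewrite /= mmul1l.
- set a1 := BinInt.Z.to_nat a; set a2 := BinInt.Z.to_nat (BinInt.Z.opp a).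
  set b1 := BinInt.Z.to_nat b; set b2 := BinInt.Z.to_nat (BinInt.Z.opp b).
  rewrite -mmulA (mmulA (mpow y a2)).
  rewrite (mpow_pq _ _ yx).
  have -> : mpow x (b1 - a2) ** mpow y (a2 - b1) = mpow x b1 ** mpow y a2.
    by apply: mpow_diff => //; lia.
  rewrite -mmulA mmulA -!mpow_add.
  apply: mpow_diff => //=; rewrite /a1 /a2 /b1 /b2; lia.
- move=> h; have [|ne] := classic (z = BinInt.Z0) => //.
  have [ge|lt] := BinInt.Z.le_gt_cases BinInt.Z0 z.
  + case: (hx (BinInt.Z.to_nat z)); first by lia.
    by move: h; have -> : BinInt.Z.to_nat (BinInt.Z.opp z) = 0 by [lia]; rewrite mmul1r.
  + case: (hx (BinInt.Z.to_nat (BinInt.Z.opp z))); first by lia.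
    move: h; have -> : BinInt.Z.to_nat z = 0 by lia.
    rewrite mmul1l => h.
    have := mpow_pq (BinInt.Z.to_nat (BinInt.Z.opp z)) (BinInt.Z.to_nat (BinInt.Z.opp z)) xy.
    by rewrite subnn h !mmul1r.
Qed.

(** The inverse is stored as data so that [ginv] needs no choice; being unique, it does not affect
    equality. *)
Record invertible (M : Mnd) := Invertible {
  inv_val : M;
  inv_inv : M;
  inv_valK : inv_val ** inv_inv = mone M;
  inv_invK : inv_inv ** inv_val = mone M }.

Lemma invertible_eq (M : Mnd) (x y : invertible M) : inv_val x = inv_val y -> x = y.
Proof.
case: x y => [x x' h1 h2] [y y' h3 h4] /= E; subst.
have E' : x' = y' := mmul_inv_unique h2 h3; subst.
by rewrite (proof_irrelevance _ h1 h3) (proof_irrelevance _ h2 h4).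
Qed.

Definition invertible_mul (M : Mnd) (x y : invertible M) : invertible M.
Proof.
refine (@Invertible M (inv_val x ** inv_val y) (inv_inv y ** inv_inv x) _ _).
- by rewrite -mmulA (mmulA (inv_val y)) inv_valK mmul1l inv_valK.
- by rewrite -mmulA (mmulA (inv_inv x)) inv_invK mmul1l inv_invK.
Defined.

Definition units_mnd (M : Mnd) : Mnd.
Proof.
refine {| mcar := invertible M; mmul := @invertible_mul M;
          mone := Invertible (mmul1l (mone M)) (mmul1l (mone M)) |}.
- by move=> x y z; apply: invertible_eq; rewrite /= mmulA.
- by move=> x; apply: invertible_eq; rewrite /= mmul1l.
- by move=> x; apply: invertible_eq; rewrite /= mmul1r.
Defined.

Definition units_grp (M : Mnd) : Grp.
Proof.
refine {| gmon := units_mnd M;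
          ginv := fun x : units_mnd M => Invertible (inv_invK x) (inv_valK x) |}.
by move=> x; apply: invertible_eq; rewrite /= inv_invK.
Defined.

Lemma units_hom (M : Mnd) : mnd_hom (fun x : units_grp M => inv_val x).
Proof. by split=> // x h; exact: invertible_eq. Qed.

(** For $u = u_1 m u_2$, [hfin] rotates $u_1(m u_2)=1$ into $m(u_2 u_1)=1$, and applied once more
    makes this inverse two-sided. *)
Lemma factor_invertible (M : Mnd) (u : list M) m :
  (forall p q : M, p ** q = mone M -> q ** p = mone M) ->
  mprod u = mone M -> In m u -> exists x : units_grp M, inv_val x = m.
Proof.
move=> hfin e hm; have [u1 [u2 E]] := in_split _ _ hm; subst.
move: e; rewrite mprod_app /= => e.
have h := hfin _ _ e; rewrite -mmulA in h.
by exists (Invertible h (hfin _ _ h)).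
Qed.

Lemma Val_CF_units (M : Mnd) :
  (forall p q : M, p ** q = mone M -> q ** p = mone M) ->
  fam_eq (Val_CF M) (Val_CF (units_grp M)).
Proof.
move=> hfin T L; split=> [[g hL]|]; last exact: Val_CF_hom (units_hom M) _ _.
by apply: Val_CF_image (units_hom M) _ hL => u _ e m; exact: factor_invertible.
Qed.

(** * Subgroups generated by finite lists *)

Section Subgroup.
Variables (G : Grp) (s : list G).

Let H := {x : G | gen_subgroup s x}.

Lemma sig_val_inj (x y : H) : sval x = sval y -> x = y.
Proof.
case: x y => [x hx] [y hy] /= E; subst.
by rewrite (proof_irrelevance _ hx hy).
Qed.

Definition subgroup_mnd : Mnd.
Proof.
refine {| mcar := H;
          mmul := fun x y => exist _ _ (gen_mul (svalP x) (svalP y));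
          mone := exist _ _ (gen_one s) |}.
- by move=> x y z; apply: sig_val_inj; rewrite /= mmulA.
- by move=> x; apply: sig_val_inj; rewrite /= mmul1l.
- by move=> x; apply: sig_val_inj; rewrite /= mmul1r.
Defined.

Definition subgroup_grp : Grp.
Proof.
refine {| gmon := subgroup_mnd;
          ginv := fun x : subgroup_mnd => exist _ _ (gen_inv (svalP x)) |}.
by move=> x; apply: sig_val_inj; rewrite /= ginvl.
Defined.

Lemma subgroup_hom : mnd_hom (fun x : subgroup_grp => sval x).
Proof. by split=> // x h; exact: sig_val_inj. Qed.

End Subgroup.

Lemma finite_sig (X : Type) (P : X -> Prop) (l : list X) :
  (forall x, P x -> In x l) -> finite_type {x | P x}.
Proof.
move=> hl.
suff [l' hl'] : exists l' : list {x | P x}, forall y, In (sval y) l -> In y l'.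
  by exists l' => y; apply/hl'/hl/(svalP y).
elim: l {hl} => [|x l [l' IH]]; first by exists nil.
have [hx|hx] := classic (P x).
- exists (exist _ x hx :: l') => y /= [E|/IH]; last by right.
  left; case: y E => y hy /= E; subst.
  by rewrite (proof_irrelevance _ hx hy).
- exists l' => y /= [E|/IH //].
  by case: hx; rewrite E; exact: svalP.
Qed.

(** The valences of the finitely many rules generate a finite subgroup. *)
Lemma Val_CF_locally_finite (G : Grp) (T : finType) L : locally_finite G ->
  Val_CF G (T := T) L -> exists H : Grp, finite_type H /\ Val_CF H L.
Proof.
move=> lf [g hL].
pose s := map (fun r : vg_V g * list (vg_V g + T) * G => r.2) (vg_P g).
exists (subgroup_grp s); split.
- by have [l hl] := lf s; exact: finite_sig hl.
- apply: Val_CF_image (subgroup_hom s) _ hL => u hu _ m /hu [A [al hm]].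
  have hs : gen_subgroup s m.
    apply: gen_in.
    exact: (in_map (fun r : vg_V g * list (vg_V g + T) * G => r.2)) hm.
  by exists (exist _ m hs).
Qed.

(** * Finite index of shuffle equivalence over a finite group *)

Definition gconj (G : Grp) (p a : G) : G := p ** a ** ginv p.

Lemma ginvr (G : Grp) (x : G) : x ** ginv x = mone G.
Proof.
have h := ginvl (ginv x).
by rewrite -{1}(mmul1l x) -h -!mmulA (mmulA (ginv x)) ginvl mmul1l ginvl.
Qed.

Lemma mmul_fix_l (G : Grp) (x y : G) : x ** y = y -> x = mone G.
Proof. by move=> h; rewrite -(mmul1r x) -(ginvr y) mmulA h. Qed.

Lemma conj1 (G : Grp) (p : G) : gconj p (mone G) = mone G.
Proof. by rewrite /gconj mmul1r ginvr. Qed.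

Lemma conjM (G : Grp) (p a b : G) : gconj p (a ** b) = gconj p a ** gconj p b.
Proof. by rewrite /gconj -!mmulA (mmulA (ginv p)) ginvl mmul1l. Qed.

Lemma conj_inj (G : Grp) (p a b : G) : gconj p a = gconj p b -> a = b.
Proof.
move=> h.
have E c : ginv p ** gconj p c ** p = c.
  by rewrite /gconj -!mmulA ginvl mmul1r mmulA ginvl mmul1l.
by rewrite -(E a) h E.
Qed.

(** Both sides are $p a x u^{-1} a^{-1} p^{-1}$: a letter passes into the conjugating prefix. *)
Lemma conj_ratioM (G : Grp) (p a x u : G) :
  gconj (p ** a) (x ** ginv u) = gconj p (a ** x ** ginv (a ** u)).
Proof.
have h : ginv (p ** a) = ginv a ** ginv p.
  apply: (@mmul_inv_unique G (p ** a)); first exact: ginvl.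
  by rewrite -mmulA (mmulA a) ginvr mmul1l ginvr.
have h' : ginv (a ** u) = ginv u ** ginv a.
  apply: (@mmul_inv_unique G (a ** u)); first exact: ginvl.
  by rewrite -mmulA (mmulA u) ginvr mmul1l ginvr.
by rewrite /gconj h h' -!mmulA.
Qed.

(* [inserts w k g]: g is a product of the conjugates of the successive letters
   of k by letters of w whose positions in w are weakly increasing. *)
Inductive inserts (G : Grp) : list G -> list G -> G -> Prop :=
| inserts_stop : inserts nil nil (mone G)
| inserts_take p w a k g :
    inserts (p :: w) k g -> inserts (p :: w) (a :: k) (gconj p a ** g)
| inserts_skip p w k g : inserts w k g -> inserts (p :: w) k g.

Fixpoint walk (G : Grp) (p : G) (u : list G) : list G :=
  p :: if u is a :: u' then walk (p ** a) u' else nil.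

(* Moving the inserted letters to the front of the product conjugates each of
   them by the prefix of u before it. *)
Lemma shuffle_inserts (G : Grp) (u k x : list G) p : shuffle u k x ->
  inserts (walk p u) k (gconj p (mprod x ** ginv (mprod u))).
Proof.
move=> h; elim: h p => {u k x} [|a u k x _ IH|a u k x _ IH] p.
- by rewrite /= ginvr conj1; apply: inserts_skip; exact: inserts_stop.
- by rewrite /= -conj_ratioM; exact: inserts_skip.
- rewrite [mprod _]/= -mmulA conjM.
  by case: u IH => [|b u] IH; apply: inserts_take; exact: IH.
Qed.

(** An [inserts_take] puts a letter of [k] into the shuffle, an [inserts_skip] the next letter of
    [u]; skipping the last prefix ends both words. *)
Lemma inserts_shuffle (G : Grp) (u k : list G) p h : inserts (walk p u) k h ->
  exists2 x, shuffle u k x & gconj p (mprod x ** ginv (mprod u)) = h.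
Proof.
move E: (walk p u) => w hw.
elim: hw u p E => {w k h} [|q w a k g _ IH|q w k g hw IH] u p E.
- by case: u E.
- have [x hx <-] := IH _ _ E; exists (a :: x); first by constructor.
  rewrite /= -mmulA conjM; congr (_ ** _).
  by case: u E {IH hx} => [|? ?] [->].
- case: u E => [|b u] [-> E].
    rewrite -E in hw; inversion hw; subst.
    by exists nil; [constructor | rewrite /= ginvr conj1].
  have [x hx <-] := IH _ _ E; exists (b :: x); first by constructor.
  by rewrite conj_ratioM.
Qed.

Lemma inserts_nil (G : Grp) (w : list G) : inserts w nil (mone G).
Proof. by elim: w => *; constructor. Qed.

Lemma inserts_app (G : Grp) (w1 w2 k1 k2 : list G) g1 g2 :
  inserts w1 k1 g1 -> inserts w2 k2 g2 -> inserts (w1 ++ w2) (k1 ++ k2) (g1 ** g2).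
Proof.
move=> h1 h2; elim: h1 => [|p w a k g _ IH|p w k g _ IH] /=.
- by rewrite mmul1l.
- by rewrite -mmulA; exact: inserts_take.
- exact: inserts_skip.
Qed.

Lemma inserts_app_inv (G : Grp) (w1 w2 k : list G) g :
  inserts (w1 ++ w2) k g -> exists k1 k2 g1 g2,
    [/\ k = k1 ++ k2, g = g1 ** g2, inserts w1 k1 g1 & inserts w2 k2 g2].
Proof.
move E: (w1 ++ w2) => w h.
elim: h w1 E => {w k g} [|p w a k g h IH|p w k g h IH] [|q w1] //= E.
- exists nil, nil, (mone G), (mone G); rewrite mmul1l E; split=> //; exact: inserts_nil.
- exists nil, (a :: k), (mone G), (gconj p a ** g); rewrite mmul1l E; split=> //.
    exact: inserts_nil.
  exact: inserts_take.
- have [k1 [k2 [g1 [g2 [-> -> h1 h2]]]]] := IH (q :: w1) E.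
  exists (a :: k1), k2, (gconj p a ** g1), g2; rewrite mmulA; split=> //.
  by case: E => <- _; exact: inserts_take.
- exists nil, k, (mone G), g; rewrite mmul1l E; split=> //; first exact: inserts_nil.
  exact: inserts_skip.
- case: E => -> E.
  have [k1 [k2 [g1 [g2 [-> -> h1 h2]]]]] := IH _ E.
  by exists k1, k2, g1, g2; split=> //; exact: inserts_skip.
Qed.

Lemma inserts_at (G : Grp) (z k : list G) x :
  In x z -> inserts z k (gconj x (mprod k)).
Proof.
elim: z => //= y z IH [->|/IH]; last exact: inserts_skip.
elim: k {IH} => [|a k IH] /=; first by rewrite conj1; exact: inserts_nil.
by rewrite conjM; exact: inserts_take.
Qed.

Definition ins_equiv (G : Grp) (w w' : list G) : Prop :=
  forall k g, inserts w k g <-> inserts w' k g.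

Lemma ins_equiv_app (G : Grp) (w1 w2 w1' w2' : list G) :
  ins_equiv w1 w1' -> ins_equiv w2 w2' -> ins_equiv (w1 ++ w2) (w1' ++ w2').
Proof.
move=> h1 h2 k g; split=> /inserts_app_inv [k1 [k2 [g1 [g2 [-> -> /h1 i1 /h2 i2]]]]];
  exact: inserts_app.
Qed.

(** Representatives are listed instead of forming a quotient; they need not satisfy [Q]
    themselves. *)
Definition finite_classes (G : Grp) (Q : list G -> Prop) : Prop :=
  exists l, forall w, Q w -> exists2 w', In w' l & ins_equiv w w'.

Lemma finite_classes_sub (G : Grp) (Q Q' : list G -> Prop) :
  (forall w, Q w -> Q' w) -> finite_classes Q' -> finite_classes Q.
Proof. by move=> h [l hl]; exists l => w /h /hl. Qed.

Lemma finite_classes_or (G : Grp) (Q Q' : list G -> Prop) :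
  finite_classes Q -> finite_classes Q' -> finite_classes (fun w => Q w \/ Q' w).
Proof.
move=> [l hl] [l' hl']; exists (l ++ l') => w [/hl|/hl'] [w' h ?];
  by exists w' => //; apply: in_or_app; tauto.
Qed.

Lemma finite_classes_app (G : Grp) (Q Q' : list G -> Prop) :
  finite_classes Q -> finite_classes Q' ->
  finite_classes (fun w => exists w1 w2, [/\ w = w1 ++ w2, Q w1 & Q' w2]).
Proof.
move=> [l hl] [l' hl'].
exists (map (fun p => p.1 ++ p.2) (list_prod l l')).
move=> w [w1 [w2 [-> /hl [w1' i1 e1] /hl' [w2' i2 e2]]]].
exists (w1' ++ w2'); last exact: ins_equiv_app.
apply: (in_map (fun p => p.1 ++ p.2) _ (w1', w2')).
exact: in_prod.
Qed.

Lemma finite_classes_ex (G : Grp) (Y : Type) (X : list Y) (Q : Y -> list G -> Prop) :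
  (forall x, In x X -> finite_classes (Q x)) ->
  finite_classes (fun w => exists2 x, In x X & Q x w).
Proof.
elim: X => [|x X IH] h; first by exists nil => w [].
have hx := h x (or_introl erefl).
have hX := IH (fun y hy => h y (or_intror hy)).
apply: finite_classes_sub (finite_classes_or hx hX) => w [y [<-|hy] hw]; first by left.
by right; exists y.
Qed.

Lemma finite_classes_eq (G : Grp) (w0 : list G) : finite_classes (eq w0).
Proof. by exists (w0 :: nil) => w <-; exists w0 => //; left. Qed.

(** The arch factorization of a word, without minimality of the blocks and with an arbitrary
    rest. *)
Inductive arches (X : Type) (A : list X) : nat -> list X -> Prop :=
| arches0 w : arches A 0 w
| archesS n z w : incl A z -> arches A n w -> arches A n.+1 (z ++ w).

(* The letters of k are conjugated by arbitrary letters of A; the list S bounds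
   the pairs (product, conjugated product) taken over all suffixes. *)
Inductive conj_prod (G : Grp) (A : list G) (S : list (G * G)) : list G -> G -> Prop :=
| conj_prod_nil : In (mone G, mone G) S -> conj_prod A S nil (mone G)
| conj_prod_cons x a k g :
    In x A -> conj_prod A S k g -> In (a ** mprod k, gconj x a ** g) S ->
    conj_prod A S (a :: k) (gconj x a ** g).

Lemma conj_prod_state (G : Grp) (A : list G) S k g :
  conj_prod A S k g -> In (mprod k, g) S.
Proof. by case. Qed.

Lemma inserts_conj_prod (G : Grp) (A : list G) S w k g :
  (forall s, In s S) -> incl w A -> inserts w k g -> conj_prod A S k g.
Proof.
move=> hS hw h; elim: h hw => {w k g} [|p w a k g _ IH|p w k g _ IH] hw.
- exact: conj_prod_nil.
- by apply: conj_prod_cons => //; [apply: hw; left | exact: IH].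
- by apply: IH => x hx; apply: hw; right.
Qed.

(** States belong to suffixes of [k], so the last visit to [q] is the shortest suffix with state
    [q]. The induction looks for it in the tail first; all shorter suffixes avoid [q]. *)
Lemma conj_prod_last_visit (G : Grp) (A : list G) S1 S2 q k g :
  conj_prod A (S1 ++ q :: S2) k g ->
  conj_prod A (S1 ++ S2) k g \/
  exists k1 k2, [/\ k = k1 ++ k2, mprod k2 = q.1 &
    (k2 = nil /\ q.2 = mone G) \/
    exists x a k3 g3, [/\ k2 = a :: k3, In x A, q.2 = gconj x a ** g3 &
                         conj_prod A (S1 ++ S2) k3 g3]].
Proof.
have hin s : In s (S1 ++ q :: S2) -> s <> q -> In s (S1 ++ S2).
  move=> hs; have [h|[->|h]] := in_app_or _ _ _ hs => // ne; apply: in_or_app; tauto.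
elim=> {k g} [h|x a k g hx hk IH hs].
- have [E|ne] := classic ((mone G, mone G) = q); last by left; apply/conj_prod_nil/hin.
  by right; exists nil, nil; rewrite -E; split=> //; left.
- case: IH => [h|[k1 [k2 [-> E h]]]]; last by right; exists (a :: k1), k2; split.
  have [E|ne] := classic ((a ** mprod k, gconj x a ** g) = q); last first.
    by left; apply: conj_prod_cons => //; exact: hin.
  right; exists nil, (a :: k); rewrite -E; split=> //; right.
  by exists x, a, k, g.
Qed.

(* After the last visit of the current state the list of states shrinks; before
   it, the letters of k multiply to 1 and may all be conjugated by the same
   letter. Hence a single arch is used up for every state. *)
Lemma arches_inserts (G : Grp) (A : list G) n S k g w :
  (length S <= n)%coq_nat -> conj_prod A S k g -> arches A n w -> inserts w k g.
Proof.
elim: n S k g w => [|n IH] S k g w hS hk hw.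
  by have := conj_prod_state hk; case: S hS {hk} => //= ? ?; lia.
inversion hw as [|n' z w' hz hw' E1 E2]; subst n' w.
have [S1 [S2 E]] := in_split _ _ (conj_prod_state hk); subst S.
have hS' : (length (S1 ++ S2) <= n)%coq_nat.
  by move: hS; rewrite !length_app /=; lia.
have [h|[k1 [k2 [Ek e h]]]] := conj_prod_last_visit hk.
  rewrite -(mmul1l g) -(app_nil_l k).
  by apply: inserts_app; [exact: inserts_nil | exact: IH hS' h hw'].
(* The suffix [k2] has the same state as all of [k], hence the same product. *)
have e1 : mprod k1 = mone G.
  by apply: (@mmul_fix_l _ _ (mprod k2)); rewrite -mprod_app -Ek.
subst k; case: h => [[k2E gE]|[x [a [k3 [g3 [k2E hx gE hk3]]]]]]; rewrite /= in gE; subst.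
- rewrite -(mmul1l (mone G)); apply: inserts_app; last exact: inserts_nil.
  case: k1 {e hS} e1 hk => [|b k1] e1 hk; first exact: inserts_nil.
  rewrite app_nil_r in hk.
  have [x hx] : exists x, In x A by inversion hk as [|x ? ? ? hx]; exists x.
  by have := inserts_at (b :: k1) (hz _ hx); rewrite e1 conj1.
(* Conjugated by [x] together with [a], the word [k1] contributes nothing. *)
- have -> : k1 ++ a :: k3 = (k1 ++ a :: nil) ++ k3 by rewrite -app_assoc.
  apply: inserts_app; last exact: IH hS' hk3 hw'.
  by have := inserts_at (k1 ++ a :: nil) (hz _ hx); rewrite mprod_app e1 mmul1l /= mmul1r.
Qed.

Lemma first_prefix (X : Type) (P : list X -> Prop) (w : list X) :
  P w -> ~ P nil -> exists z a w', [/\ w = z ++ a :: w', ~ P z & P (z ++ a :: nil)].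
Proof.
move=> hw hn; elim/rev_ind: w hw => // a w IH hw.
have [h|h] := classic (P w); last by exists w, a, nil.
have [z [b [w' [-> h1 h2]]]] := IH h.
by exists z, b, (w' ++ a :: nil); rewrite -app_assoc.
Qed.

Lemma incl_remove (X : Type) (A1 A2 : list X) x w :
  incl w (A1 ++ x :: A2) -> ~ In x w -> incl w (A1 ++ A2).
Proof.
move=> h hx y hy.
have [hy1|[E|hy2]] := in_app_or _ _ _ (h _ hy).
- by apply: in_or_app; left.
- by case: hx; rewrite E.
- by apply: in_or_app; right.
Qed.

(** Induction on the size of the alphabet. Words missing a letter of [A] fall under the hypothesis;
    the others are divided by whether they have [length S] arches. *)
Lemma finite_classes_incl (G : Grp) (A : list G) :
  finite_type G -> finite_classes (fun w => incl w A).
Proof.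
move=> [lG hG]; have [n hn] : exists n, (length A <= n)%coq_nat by exists (length A).
elim: n A hn => [|n IHn] A hn.
  case: A hn => [_|? ? /=]; last by lia.
  by apply: finite_classes_sub (finite_classes_eq nil) => -[|a w] // /(_ a (or_introl erefl)).
pose miss := fun w => exists2 x, In x A & incl w A /\ ~ In x w.
have fmiss : finite_classes miss.
  apply: finite_classes_ex => x hx.
  have [A1 [A2 E]] := in_split _ _ hx; subst A.
  have hl : (length (A1 ++ A2) <= n)%coq_nat by move: hn; rewrite !length_app /=; lia.
  by apply: finite_classes_sub (IHn _ hl) => w [h1 h2]; exact: incl_remove h1 h2.
have missP w : incl w A -> ~ incl A w -> miss w.
  move=> hw /not_all_ex_not [x h]; have [hx nx] := imply_to_and _ _ h.
  by exists x.
(* By induction on [m]: a prefix that misses a letter, the letter that completes the alphabet, and a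
   rest with one arch less to avoid. *)
have few m : finite_classes (fun w => incl w A /\ ~ arches A m w).
  elim: m => [|m IHm]; first by exists nil => w [_ []]; exact: arches0.
  have fletter : finite_classes (fun w => exists2 a, In a A & a :: nil = w).
    by apply: finite_classes_ex => a _; exact: finite_classes_eq.
  have f3 := finite_classes_app fmiss (finite_classes_app fletter IHm).
  apply: finite_classes_sub (finite_classes_or fmiss
    (finite_classes_or (finite_classes_eq nil) f3)).
  move=> w [hw na].
  have [full|nfull] := classic (incl A w); last by left; exact: missP.
  (* An empty [A] admits only the empty word. *)
  right; have [An|An] := classic (incl A nil).
    left; case: w hw {full na} => [//|a w] hw.
    by case: (An a (hw a (or_introl erefl))).
  right; have [z [a [w' [E nz hz]]]] := first_prefix full An; subst w.
  exists z, (a :: w'); split=> //.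
    by apply: missP nz => y hy; apply: hw; apply: in_or_app; left.
  exists (a :: nil), w'; split=> //.
    by exists a => //; apply: hw; apply: in_or_app; right; left.
  split=> [y hy|hw'].
    by apply: hw; apply: in_or_app; right; right.
  apply: na; have -> : z ++ a :: w' = (z ++ a :: nil) ++ w' by rewrite -app_assoc.
  exact: archesS.
pose S := list_prod lG lG.
(* Insertions into any such word amount to [conj_prod] over [A], so these words form a single
   class. *)
have many : finite_classes (fun w => incl w A /\ arches A (length S) w).
  have [[w0 [i0 a0]]|none] := classic (exists w0, incl w0 A /\ arches A (length S) w0).
    exists (w0 :: nil) => w [iw aw]; exists w0; first by left.
    have hS s : In s S by case: s => s1 s2; exact: in_prod.
    move=> k g; split=> h.
      exact: arches_inserts (le_n _) (inserts_conj_prod hS iw h) a0.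
    exact: arches_inserts (le_n _) (inserts_conj_prod hS i0 h) aw.
  by exists nil => w h; case: none; exists w.
apply: finite_classes_sub (finite_classes_or many (few (length S))) => w hw.
by have [h|h] := classic (arches A (length S) w); [left | right].
Qed.

(** One direction of the equivalence of words, extended to languages: the replacing word of [L'] may
    depend on [k] and on the shuffle. Words are equivalent when their singletons dominate each
    other. *)
Definition dominated (M : Mnd) (L L' : list M -> Prop) : Prop :=
  forall k u x, L u -> shuffle u k x ->
  exists u' x', [/\ L' u', shuffle u' k x' & mprod x' = mprod x].

(** Insertions determine the product of a shuffle only up to the factor [mprod u], so this product
    has to agree as well. *)
Lemma walk_dominated (G : Grp) (u v : list G) :
  ins_equiv (walk (mone G) u) (walk (mone G) v) -> mprod u = mprod v ->
  dominated (eq u) (eq v).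
Proof.
move=> h e k _ x <- hx.
have /h /inserts_shuffle [x' hx' E] := shuffle_inserts (mone G) hx.
exists v, x'; split=> //.
have E' := conj_inj E.
by rewrite -(mmul1r (mprod x')) -(ginvl (mprod v)) mmulA E' e -mmulA ginvl mmul1r.
Qed.

(** A listed class need not be the class of a walk; a representative is chosen only where one
    exists. *)
Lemma finite_representatives (X Y : Type) (rel : X -> Y -> Prop) (l : list Y) :
  exists lx, forall x y, In y l -> rel x y -> exists2 x', In x' lx & rel x' y.
Proof.
elim: l => [|y0 l [lx h]]; first by exists nil.
have [[x0 h0]|none] := classic (exists x, rel x y0).
- exists (x0 :: lx) => x y [<-|hy] hxy; first by exists x0 => //; left.
  by have [x' h1 h2] := h _ _ hy hxy; exists x' => //; right.
- exists lx => x y [E|hy] hxy; last exact: h hxy.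
  by case: none; exists x; rewrite E.
Qed.

Lemma finite_domination (G : Grp) : finite_type G ->
  exists reps : list (list G), forall u, exists2 c, In c reps &
    dominated (eq u) (eq c) /\ dominated (eq c) (eq u).
Proof.
move=> fG; have [lG hG] := fG; have [cls hcls] := finite_classes_incl lG fG.
pose rel (u : list G) p := ins_equiv (walk (mone G) u) p.1 /\ mprod u = p.2.
have [reps hreps] := finite_representatives rel (list_prod cls lG).
exists reps => u.
have [|w' hw' eu] := hcls (walk (mone G) u); first by move=> y _; exact: hG.
have [||c hc [ec pc]] := hreps u (w', mprod u); [exact: in_prod | by split|].
exists c => //; rewrite /= in ec pc.
by split; apply: walk_dominated => // k g; rewrite eu ec.
Qed.

(** * Context-freeness over finite groups *)

Lemma dominated_trans (M : Mnd) (L1 L2 L3 : list M -> Prop) :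
  dominated L1 L2 -> dominated L2 L3 -> dominated L1 L3.
Proof.
move=> h12 h23 k u x h hx.
have [u' [x' [h' hx' <-]]] := h12 _ _ _ h hx.
exact: h23 h' hx'.
Qed.

Lemma dominated_sub (M : Mnd) (L L' : list M -> Prop) :
  (forall u, L u -> L' u) -> dominated L L'.
Proof. by move=> h k u x /h hu hx; exists u, x. Qed.

Lemma dominated_prod (M : Mnd) (L L' : list M -> Prop) u : dominated L L' -> L u ->
  exists2 u', L' u' & mprod u' = mprod u.
Proof.
move=> h hu; have [u' [x' [hu' /shuffle_nil_r_inv -> e]]] := h _ _ _ hu (shuffle_nil_r u).
by exists u'.
Qed.

Definition shuffle_lang (X : Type) (L K : list X -> Prop) (w : list X) : Prop :=
  exists u v, [/\ L u, K v & shuffle u v w].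

Definition cons_lang (X : Type) (a : X) (L : list X -> Prop) (w : list X) : Prop :=
  exists2 u, L u & w = a :: u.

(** By associativity of shuffling, the words of [K] become part of the context. *)
Lemma dominated_shuffle_l (M : Mnd) (L L' K : list M -> Prop) :
  dominated L L' -> dominated (shuffle_lang L K) (shuffle_lang L' K).
Proof.
move=> h k w0 x [u [v [hu hv huv]]] hx.
have [y hvk huy] := shuffle_assoc huv hx.
have [u' [x' [hu' hx' e]]] := h _ _ _ hu huy.
have [w hw hwk] := shuffle_assoc_rev hvk hx'.
by exists w, x'; split=> //; exists u', v.
Qed.

Lemma dominated_shuffle (M : Mnd) (L L' K K' : list M -> Prop) :
  dominated L L' -> dominated K K' ->
  dominated (shuffle_lang L K) (shuffle_lang L' K').
Proof.
have sym (A B : list M -> Prop) : dominated (shuffle_lang A B) (shuffle_lang B A).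
  apply: dominated_sub => w [u [v [hu hv hs]]].
  by exists v, u; split=> //; exact: shuffle_sym.
move=> hL hK; apply: dominated_trans (dominated_shuffle_l hL) _.
apply: dominated_trans (sym _ _) _.
exact: dominated_trans (dominated_shuffle_l hK) (sym _ _).
Qed.

(** Context letters before [n] stay in place; after [n] the hypothesis applies. *)
Lemma dominated_cons (M : Mnd) (n : M) (L L' : list M -> Prop) :
  dominated L L' -> dominated (cons_lang n L) (cons_lang n L').
Proof.
move=> h k w x [u hu E] hx; elim: hx E => {w k x} [|a w k x hx _|a w k x _ IH] // E.
- case: E => ? ?; subst.
  have [u' [x' [hu' hx' e]]] := h _ _ _ hu hx.
  exists (n :: u'), (n :: x'); split; [by exists u' | by constructor | by rewrite /= e].
- have [u' [x' [hu' hx' e]]] := IH E.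
  by exists u', (a :: x'); split; [| constructor | rewrite /= e].
Qed.

Lemma finType_finite (X : finType) : finite_type X.
Proof.
exists (enum X) => x.
have : x \in enum X by rewrite mem_enum.
elim: (enum X) => //= y s IH; rewrite inE => /orP [/eqP ->|/IH]; by [left | right].
Qed.

Lemma finite_lists (X : Type) n : finite_type X ->
  exists l : list (list X), forall s, (length s <= n)%coq_nat -> In s l.
Proof.
move=> [lX hX]; elim: n => [|n [l hl]].
  by exists (nil :: nil) => -[|a s] /=; [left | lia].
exists (nil :: map (fun p => p.1 :: p.2) (list_prod lX l)) => -[|a s] /= hs; first by left.
right; apply: (in_map (fun p => p.1 :: p.2) _ (a, s)).
apply: in_prod; first exact: hX.
by apply: hl; lia.
Qed.

Lemma finite_filter (X : Type) (l : list X) (Q : X -> Prop) :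
  (forall x, Q x -> In x l) -> exists l', forall x, In x l' <-> Q x.
Proof.
move=> h.
suff [l' hl'] : exists l', forall x, In x l' <-> In x l /\ Q x.
  by exists l' => x; rewrite hl'; split=> [[]|q] //; split=> //; exact: h.
elim: l {h} => [|a l [l' IH]]; first by exists nil => x; split=> // -[].
have [qa|na] := classic (Q a).
- exists (a :: l') => x /=; rewrite IH; split=> [[<-|[]]|[[<-|] ?]]; tauto.
- exists l' => x /=; rewrite IH; split=> [[]|[[E|] ?]]; try tauto.
  by case: na; rewrite E.
Qed.

Section FiniteGroup.
Variables (H : Grp) (T : finType) (g : valence_grammar H T) (reps : list (list H)).
Hypothesis repsP : forall u : list H, exists2 c, In c reps &
  dominated (eq u) (eq c) /\ dominated (eq c) (eq u).

Let V := vg_V g.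
Let I := 'I_(length reps).
Let rep (i : I) : list H := nth i reps nil.

Let typed := list (V * I + T).

Definition forget (s : V * I + T) : V + T :=
  match s with inl p => inl p.1 | inr t => inr t end.

Definition embed (s : V * I + T) : option (V * I) + T :=
  match s with inl p => inl (Some p) | inr t => inr t end.

(** Nonterminals are derived independently, whence the shuffle; terminals carry no labels. *)
Fixpoint rep_lang (b : typed) : list H -> Prop :=
  match b with
  | nil => eq nil
  | inl p :: b' => shuffle_lang (eq (rep p.2)) (rep_lang b')
  | inr _ :: b' => rep_lang b'
  end.

(* The nonterminal (A, i) guesses that the rules applied below an occurrence of
   A are labelled, in order, by a word equivalent to the i-th representative. *)
Definition typed_rule (A : option (V * I)) (al : list (option (V * I) + T))
    (_ : unit) : Prop :=
  match A with
  | None => exists2 i, al = inl (Some (vg_S g, i)) :: nil & mprod (rep i) = mone H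
  | Some p => exists b n, [/\ al = map embed b, vg_rule (g := g) p.1 (map forget b) n &
                dominated (eq (rep p.2)) (cons_lang n (rep_lang b))]
  end.

Lemma rep_exists u : exists i, dominated (eq u) (eq (rep i)) /\ dominated (eq (rep i)) (eq u).
Proof.
have [c hc h] := repsP u.
have [n [hn E]] := In_nth _ _ nil hc.
have hn' : n < length reps by apply/ltP.
by exists (Ordinal hn'); rewrite /rep /= E.
Qed.

(** Domination passes through [cons_lang] and shuffles, so the guesses are correct bottom up. The
    inner induction on [b] treats the siblings; the bound [N] serves the derivation below a rule,
    whose right side is no part of [b]. *)
Lemma typed_sound N b u w : (length u <= N)%coq_nat ->
  deriv typed_rule (map embed b) u (map inr w) ->
  dominated (rep_lang b)
    (fun v => deriv (vg_rule (g := g)) (map forget b) v (map inr w)).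
Proof.
elim: N b u w => [|N IHN]; elim=> [|s b IHb] u w hu.
1,3: move=> /deriv_nil_inv [_ ->]; apply: dominated_sub => _ <-; exact: deriv_refl.
all: move=> /(@deriv_app_inv _ _ _ _ (embed s :: nil)) [w1 [w2 [u1 [u2 [-> hs h1 h2]]]]].
all: have hl := shuffle_length hs.
all: have hu2 : (length u2 <= length u)%coq_nat by lia.
all: have {}IHb := IHb u2 w2 (PeanoNat.Nat.le_trans _ _ _ hu2 hu) h2.
all: case: s h1 => [[A i]|t] h1 /=.
2,4: have [_ ->] := deriv_terminal_inv h1; apply: dominated_trans IHb _;
  apply: dominated_sub => v hv;
  apply: (deriv_shuffle (deriv_refl _ (inr t :: nil)) hv); exact: shuffle_nil_l.
all: have [al [x [v [E [b1 [n [-> hP hd]]] hv]]]] := deriv_nonterminal_inv h1.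
all: rewrite E /= in hl.
  by lia.
have hv' : (length v <= N)%coq_nat by lia.
have h := IHN _ _ _ hv' hv.
apply: dominated_trans (dominated_shuffle (dominated_trans hd (dominated_cons h)) IHb) _.
apply: dominated_sub => y [y1 [y2 [[y1' hy1 ->] hy2 hy]]].
rewrite map_app; apply: (deriv_shuffle (a1 := inl A :: nil) _ hy2 hy).
apply: (@deriv_step _ _ _ _ nil) hP _.
by rewrite app_nil_r.
Qed.

Lemma typed_complete N al u w : (length u <= N)%coq_nat ->
  deriv (vg_rule (g := g)) al u (map inr w) ->
  exists b v, [/\ map forget b = al, dominated (eq u) (rep_lang b) &
                deriv typed_rule (map embed b) v (map inr w)].
Proof.
elim: N al u w => [|N IHN]; elim=> [|s al IHal] u w hu.
1,3: move=> /deriv_nil_inv [-> ->]; exists nil, nil; split=> //;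
  [exact: dominated_sub | exact: deriv_refl].
all: move=> /(@deriv_app_inv _ _ _ _ (s :: nil)) [w1 [w2 [u1 [u2 [-> hs h1 h2]]]]].
all: have hl := shuffle_length hs.
all: have hu2 : (length u2 <= length u)%coq_nat by lia.
all: have [b [v [hb hd hv]]] := IHal u2 w2 (PeanoNat.Nat.le_trans _ _ _ hu2 hu) h2.
all: case: s h1 => [A|t] h1.
2,4: have [E ->] := deriv_terminal_inv h1; subst u1;
  have -> : u = u2 by [apply: shuffle_nil_r_inv (shuffle_sym hs)];
  exists (inr t :: b), v; split; [by rewrite /= hb | by [] |];
  apply: (deriv_shuffle (deriv_refl _ (inr t :: nil)) hv); exact: shuffle_nil_l.
all: have [al' [n [v1 [E hP hv1]]]] := deriv_nonterminal_inv h1.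
all: rewrite E /= in hl.
  by lia.
have hv1' : (length v1 <= N)%coq_nat by lia.
have [b1 [v' [hb1 hd1 hv']]] := IHN _ _ _ hv1' hv1.
(* The guess for [A] is the class of all labels below it, that of its own rule included. *)
have [i [hui hiu]] := rep_exists u1.
(* Labels of the typed grammar carry no information, so the derivation from [A] may simply come
   first. *)
exists (inl (A, i) :: b), ((tt :: v') ++ v); split.
- by rewrite /= hb.
- apply: dominated_trans (dominated_shuffle hui hd).
  by apply: dominated_sub => _ <-; exists u1, u2.
- rewrite map_app; apply: (@deriv_shuffle _ _ _ _ (inl (Some (A, i)) :: nil) (tt :: v'))
    hv (shuffle_cat _ _).
  apply: (@deriv_step _ _ _ _ nil) _ _; last by rewrite app_nil_r; exact: hv'.
  exists b1, n; rewrite hb1; split=> //.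
  apply: dominated_trans hiu _.
  apply: dominated_trans (dominated_cons hd1).
  by apply: dominated_sub => _ <-; exists v1.
Qed.

(** Domination with the empty context preserves products, so guessing a class of product 1 for the
    start symbol expresses acceptance. *)
Lemma typed_language w :
  vg_language g w <->
  exists u, deriv typed_rule (inl None :: nil) u (map inr w).
Proof.
rewrite vg_languageP; split=> [[u hu e]|[u0 hu0]].
- have [b [v [hb hd hv]]] := typed_complete (le_n _) hu.
  case: b hb hd hv => [|[[A i]|t] [|? ?]] //= [->] hd hv.
  exists (tt :: v).
  apply: (@deriv_step _ _ _ _ nil None nil (inl (Some (vg_S g, i)) :: nil)) hv.
  exists i => //.
  have [_ [v1 [v2 [<- <- /shuffle_nil_r_inv ->]]]] := dominated_prod hd erefl.
  by rewrite e.
- have [al [x [v [_ [i E e] hv]]]] := deriv_nonterminal_inv hu0; subst al.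
  have h := @typed_sound _ (inl (vg_S g, i) :: nil) _ _ (le_n _) hv.
  have hi : rep_lang (inl (vg_S g, i) :: nil) (rep i).
    by exists (rep i), nil; split=> //; exact: shuffle_nil_r.
  have [u' hu' e'] := dominated_prod h hi.
  by exists u' => //; rewrite e'.
Qed.

Lemma typed_rules_finite : exists P, forall A al, In (A, al) P <-> typed_rule A al tt.
Proof.
have [N hN] : exists N, forall r, In r (vg_P g) -> (length r.1.2 <= N)%coq_nat.
  elim: (vg_P g) => [|r P [N IH]]; first by exists 0.
  exists (length r.1.2 + N) => r' [<-|/IH]; lia.
have [lV hV] := finType_finite (option (V * I)).
(* The successor leaves room for the start rules, of length 1, even when [N] is 0. *)
have [l hl] := finite_lists N.+1 (finType_finite (option (V * I) + T)%type).
have [|P hP] := @finite_filter _ (list_prod lV l) (fun r => typed_rule r.1 r.2 tt).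
  move=> [[[A i]|] al] /=; last by move=> [i -> _]; apply: in_prod => //; apply: hl => /=; lia.
  move=> [b [n [-> /hN hP _]]]; apply: in_prod => //; apply: hl.
  by move: hP; rewrite /= !length_map; lia.
by exists P => A al; rewrite hP.
Qed.

Lemma finite_group_language : CF (vg_language g).
Proof.
have [P hP] := typed_rules_finite.
exists {| cf_V := option (V * I); cf_P := P; cf_S := None |} => w.
rewrite typed_language cf_derivesP; split=> -[u hu]; exists (map id u);
  by apply: deriv_map hu => A al []; rewrite /cf_rule /= hP.
Qed.

End FiniteGroup.

Lemma Val_CF_finite_group (H : Grp) : finite_type H -> fam_sub (Val_CF H) CF.
Proof.
move=> fH T L [g hL].
have [reps hreps] := finite_domination fH.
have [g' hg'] := finite_group_language g hreps.
by exists g' => w; rewrite hL hg'.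
Qed.

Theorem theorem2 (M : Mnd) :
  fam_eq (Val_CF M) CF \/
  fam_sub (Val_CF Bicyclic) (Val_CF M) \/
  fam_sub (Val_CF Zadd) (Val_CF M) \/
  (exists G : Grp, ~ finite_type G /\ periodic G /\ ~ locally_finite G /\
     fam_eq (Val_CF M) (Val_CF G)).
Proof.
have [hfin|] := classic (forall p q : M, p ** q = mone M -> q ** p = mone M); last first.
  move=> /not_all_ex_not [p] /not_all_ex_not [q] h.
  have [pq qp] := imply_to_and _ _ h.
  by right; left; exact: Val_CF_hom (bicyclic_hom pq qp).
have hU := Val_CF_units hfin; set G := units_grp M in hU.
have [per|] := classic (periodic G); last first.
  move=> /not_all_ex_not [x hx]; right; right; left.
  have hx' n : 0 < n -> mpow x n <> mone G by move=> n0 e; apply: hx; exists n.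
  have hv : x ** ginv x = mone G by apply: invertible_eq; rewrite /= inv_valK.
  have hZ := Val_CF_hom (integers_hom hv (ginvl x) hx').
  by move=> T L /hZ /hU.
have [lf|nlf] := classic (locally_finite G).
- left=> T L; split=> [/hU hL|]; last exact: CF_sub_Val_CF.
  by have [H [/Val_CF_finite_group fH /fH]] := Val_CF_locally_finite lf hL.
(* [G] is infinite, since a list of all its elements would bound every subgroup. *)
- do 3 right; exists G; split=> // -[l hl].
  by apply: nlf => s; exists l.
Qed.
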